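(* Let $\mathcal X$ be a discrete instance space with improvement graph $G=(\mathcal X,E)$ (unweighted, with a self-loop at every node, no bound on degrees), let $\mathcal Y=\{0,1\}$ with label $1$ preferred to label $0$, and let $\mathcal H\subseteq\{0,1\}^{\mathcal X}$ be a nonempty hypothesis class. In the realizable online learning with improvement game, the optimal number of mistakes for deterministic learners equals $\mathrm{ILdim}(\mathcal H)$, the improvement Littlestone dimension of $\mathcal H$.
   Context: Improvement graph: $G=(\mathcal X,E)$ is a directed graph; $\Delta(x)=\{v:(x,v)\in E\}$ is the improvement set of $x$, and $x\in\Delta(x)$ for all $x$. Best response: for $h:\mathcal X\to\{0,1\}$ and $x\in\mathcal X$ let $\Delta_h^+(x)=\{x'\in\Delta(x):h(x')=1\}$, and let $\Delta_h(x)=\Delta_h^+(x)$ if $h(x)=0$ and $\Delta_h^+(x)\neq\emptyset$, and $\Delta_h(x)=\{x\}$ otherwise. Game: at each round $t=1,2,\dots$: (1) the environment presents $x^{(t)}\in\mathcal X$; (2) the learner, as a deterministic function of everything it has observed so far, implements a hypothesis $h^{(t)}:\mathcal X\to\{0,1\}$; (3) the agent moves to some $v^{(t)}\in\Delta_{h^{(t)}}(x^{(t)})$ (chosen adversarially if there are several elements); (4) the environment selects $y^{(t)}\in\{0,1\}$; (5) the learner makes a mistake iff $h^{(t)}(v^{(t)})\ne y^{(t)}$; (6) the learner is told whether it made a mistake. A run is realizable by $\mathcal H$ if there is $h^*\in\mathcal H$ with $h^*(v^{(t)})=y^{(t)}$ for all $t$; only realizable runs are considered. The optimal number of mistakes for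 deterministic learners is the infimum over deterministic learners of the supremum, over all realizable runs, of the number of mistakes (possibly $\infty$). Improvement Littlestone tree (ILT): a rooted tree whose nodes are labeled by elements of $\mathcal X$, such that each internal node labeled $x$ has exactly $|\Delta(x)|+1$ outgoing edges, labeled $(x,1)$ and $(v,0)$ for each $v\in\Delta(x)$ (including $v=x$). The depth of a tree is the length (number of edges) of its shortest root-to-leaf branch. An ILT is shattered by $\mathcal H$ if for every root-to-leaf path, with edge labels $(u^{(1)},y^{(1)}),(u^{(2)},y^{(2)}),\dots$, there is $h\in\mathcal H$ with $h(u^{(i)})=y^{(i)}$ for all $i$ along the path. $\mathrm{ILdim}(\mathcal H)$ is the maximum depth of an ILT shattered by $\mathcal H$ ($\infty$ if shattered ILTs of arbitrarily large depth exist; a single-node tree has depth $0$). *)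

(* Defs.v *)
From mathcomp Require Import all_boot all_order all_algebra.
From mathcomp Require Import all_classical all_reals all_analysis.

Set Implicit Arguments.
Unset Strict Implicit.
Unset Printing Implicit Defensive.

Import Order.TTheory GRing.Theory Num.Theory.
Local Open Scope classical_set_scope.
Local Open Scope ring_scope.

(* A directed graph on X is its edge set E : set (X * X); labels and hypotheses
   are bool-valued, with true for the preferred label 1. *)

Definition improvement_set (X : Type) (E : set (X * X)) (x : X) : set X :=
  [set v | E (x, v)].

Definition positive_improvements (X : Type) (E : set (X * X)) (h : X -> bool)
    (x : X) : set X :=
  [set v | improvement_set E x v /\ h v = true].

Definition best_response (X : Type) (E : set (X * X)) (h : X -> bool)
    (x : X) : set X :=
  if ~~ h x && `[< positive_improvements E h x !=set0 >]
  then positive_improvements E h x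
  else [set x].

(* The list records, oldest round first, the arriving instance, the point the
   agent moved to and whether a mistake was made; the second argument is the
   instance of the current round. Past hypotheses are left out of the list since
   a deterministic learner can recompute them. *)
Definition learner (X : Type) := seq (X * X * bool) -> X -> (X -> bool).

(* Everything chosen by the environment and the agents; round t+1 has index t.
   As the learner is deterministic, quantifying over such sequences is the same
   as quantifying over adaptive adversaries. *)
Record run (X : Type) := Run {
  arrival : nat -> X;
  move : nat -> X;
  label : nat -> bool
}.

Fixpoint history (X : Type) (L : learner X) (r : run X) (t : nat) :
    seq (X * X * bool) :=
  if t is s.+1 then
    let past := history L r s in
    rcons past (arrival r s, move r s,
                L past (arrival r s) (move r s) != label r s)
  else [::].

Definition hypothesis_at (X : Type) (L : learner X) (r : run X) (t : nat) :
    X -> bool :=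
  L (history L r t) (arrival r t).

Definition mistake (X : Type) (L : learner X) (r : run X) (t : nat) : bool :=
  hypothesis_at L r t (move r t) != label r t.

Definition is_run_of (X : Type) (E : set (X * X)) (L : learner X) (r : run X) :
    Prop :=
  forall t, best_response E (hypothesis_at L r t) (arrival r t) (move r t).

Definition realizable (X : Type) (H : set (X -> bool)) (r : run X) : Prop :=
  exists2 h, H h & forall t, h (move r t) = label r t.

Definition num_mistakes (R : realType) (X : Type) (L : learner X) (r : run X) :
    \bar R :=
  (\sum_(0 <= t <oo) ((mistake L r t)%:R)%:E)%E.

Definition worst_case_mistakes (R : realType) (X : Type) (E : set (X * X))
    (H : set (X -> bool)) (L : learner X) : \bar R :=
  ereal_sup [set num_mistakes R L r | r in
               [set r | is_run_of E L r /\ realizable H r]].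

Definition optimal_mistakes (R : realType) (X : Type) (E : set (X * X))
    (H : set (X -> bool)) : \bar R :=
  ereal_inf [set worst_case_mistakes R E H L | L in [set: learner X]].

(* Trees are well-founded (every branch is finite) but may branch infinitely:
   the argument improvement_set E x of the last field is the subtype of the
   improvement set. With infinite branches allowed, leafless trees would be
   vacuously shattered. *)
Inductive ilt (X : Type) (E : set (X * X)) : Type :=
| Leaf (x : X)
| Node (x : X) (pos : ilt E) (neg : improvement_set E x -> ilt E).

Arguments Leaf {X E} x.
Arguments Node {X E} x pos neg.

Inductive branch (X : Type) (E : set (X * X)) :
    ilt E -> seq (X * bool) -> Prop :=
| branch_leaf (x : X) : branch (Leaf x) [::]
| branch_pos (x : X) (pos : ilt E) (neg : improvement_set E x -> ilt E)
    (s : seq (X * bool)) :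
    branch pos s -> branch (Node x pos neg) ((x, true) :: s)
| branch_neg (x : X) (pos : ilt E) (neg : improvement_set E x -> ilt E)
    (v : improvement_set E x) (s : seq (X * bool)) :
    branch (neg v) s -> branch (Node x pos neg) ((val v, false) :: s).

Definition ilt_depth (R : realType) (X : Type) (E : set (X * X)) (T : ilt E) :
    \bar R :=
  ereal_inf [set ((size s)%:R)%:E | s in [set s | branch T s]].

Definition shattered (X : Type) (E : set (X * X)) (H : set (X -> bool))
    (T : ilt E) : Prop :=
  forall s, branch T s -> exists2 h, H h & all (fun e => h e.1 == e.2) s.

Definition ILdim (R : realType) (X : Type) (E : set (X * X))
    (H : set (X -> bool)) : \bar R :=
  ereal_sup [set ilt_depth R T | T in [set T : ilt E | shattered H T]].

(* Main.v *)
Require Import Defs.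
From mathcomp Require Import all_boot all_order all_algebra.
From mathcomp Require Import all_classical all_reals all_analysis.
Local Open Scope classical_set_scope.

(** Whether ILdim(H) >= n is governed by a recursive condition on version spaces:
    V has dimension at least n+1 iff some x leaves dimension at least n both in
    {h in V | h x = 1} and in {h in V | h v = 0} for every improvement v of x.
    If V has dimension exactly n, the learner shown x looks for an improvement v
    with {h in V | h v = 0} of dimension < n and predicts 1 at v only; if there is
    none, {h in V | h x = 1} has dimension < n and it predicts 0 everywhere.
    Every mistake then lowers the dimension of the version space. Conversely, an
    adversary holding a version space of dimension n+1 and its witness x forces a
    mistake and keeps dimension n: it answers 0 if the agent can end at a point
    predicted 1, and otherwise the agent stays at x and it answers 1. *)

Set Implicit Arguments.
Unset Strict Implicit.
Unset Printing Implicit Defensive.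

Import Order.TTheory GRing.Theory Num.Theory.

(** * Dimension of version spaces and shattered trees *)

Definition restrict (X : Type) (V : set (X -> bool)) (v : X) (b : bool) :
    set (X -> bool) :=
  [set h | V h /\ h v = b].

Fixpoint ildim_ge (X : Type) (E : set (X * X)) (n : nat) (V : set (X -> bool)) :
    Prop :=
  if n is m.+1 then
    exists x, ildim_ge E m (restrict V x true) /\
      forall v, improvement_set E x v -> ildim_ge E m (restrict V v false)
  else V !=set0.

Section IldimGe.
Variables (X : Type) (E : set (X * X)).
Implicit Types (V W : set (X -> bool)) (T : ilt E) (n : nat).

Lemma ildim_ge_subset n V W : V `<=` W -> ildim_ge E n V -> ildim_ge E n W.
Proof.
elim: n V W => [|n IH] V W VW /=; first by case=> h /VW ?; exists h.
have res v b : restrict V v b `<=` restrict W v b by move=> h [/VW].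
move=> [x [Dx Dv]]; exists x; split; first exact: IH (res _ _) Dx.
by move=> v /Dv; apply: IH.
Qed.

Lemma ildim_geS n V : ildim_ge E n.+1 V -> ildim_ge E n V.
Proof.
move=> [x [Dx _]]; apply: ildim_ge_subset Dx.
by move=> h [].
Qed.

Lemma ildim_ge_leq m n V : m <= n -> ildim_ge E n V -> ildim_ge E m V.
Proof.
move=> /subnK <-; elim: (n - m) => // k IH.
by rewrite addSn => /ildim_geS.
Qed.

Lemma ildim_exact V k : V !=set0 -> ~ ildim_ge E k V ->
  exists n, ildim_ge E n V /\ ~ ildim_ge E n.+1 V.
Proof.
move=> V0; elim: k => [//|k IH] nDk.
by have [Dk|/IH//] := pselect (ildim_ge E k V); exists k.
Qed.

Lemma branch_inv T s : branch T s ->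
  match T with
  | Leaf _ => s = [::]
  | Node x pos neg =>
      (exists2 s', branch pos s' & s = (x, true) :: s') \/
      (exists v, exists2 s', branch (neg v) s' & s = (val v, false) :: s')
  end.
Proof.
by case=> // x pos neg; [move=> s' ? | move=> v s' ?]; [left | right; exists v];
  exists s'.
Qed.

(** By induction on the tree: the subtree below an edge labeled [(v, b)] is shattered by
    [restrict V v b]. *)
Lemma shattered_ildim_ge T n V :
  shattered V T -> (forall s, branch T s -> n <= size s) -> ildim_ge E n V.
Proof.
elim: T n V => [x|x pos IHpos neg IHneg] [|n] V shT depT.
- by have [h Vh _] := shT _ (branch_leaf E x); exists h.
- by have := depT _ (branch_leaf E x).
(* Here only a member of [V] is sought: follow positive edges, which always exist, down to a
   leaf. *)
- apply: (@ildim_ge_subset 0 (restrict V x true)); first by move=> h [].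
  apply: (IHpos 0) => // s Bs.
  by have [h Vh /= /andP[/eqP hx ?]] := shT _ (branch_pos neg Bs); exists h.
- exists x; split.
    apply: IHpos => s Bs; last exact: depT _ (branch_pos neg Bs).
    by have [h Vh /= /andP[/eqP hx ?]] := shT _ (branch_pos neg Bs); exists h.
  move=> v xv; have xv' : v \in improvement_set E x by rewrite inE.
  apply: (IHneg (exist _ v xv')) => s Bs.
    have [h Vh /= /andP[/eqP hx ?]] := shT _ (branch_neg pos Bs).
    by exists h.
  exact: depT _ (branch_neg pos Bs).
Qed.

Lemma ildim_ge_shattered (x0 : X) n V : ildim_ge E n V ->
  exists T, shattered V T /\ forall s, branch T s -> n <= size s.
Proof.
elim: n V => [|n IH] V.
  case=> h Vh; exists (Leaf x0); split=> // s /branch_inv ->.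
  by exists h.
move=> [x [/IH[pos [shpos deppos]] Dv]].
(* Choice picks all negative subtrees at once, as there may be infinitely many improvements. *)
have /choice[neg negP] (v : improvement_set E x) :
    exists T, shattered (restrict V (val v) false) T /\
      forall s, branch T s -> n <= size s.
  by apply: IH; apply: Dv; have := valP v; rewrite inE.
exists (Node x pos neg); split => s /branch_inv[[s' Bs ->]|[v [s' Bs ->]]].
- by have [h [Vh hx] hs] := shpos _ Bs; exists h => //=; rewrite hx eqxx.
- have [h [Vh hx] hs] := (negP v).1 _ Bs.
  by exists h => //=; rewrite hx eqxx.
- exact: deppos.
- exact: (negP v).2.
Qed.

End IldimGe.

(** * The adversary *)

Section Adversary.
Variables (X : Type) (E : set (X * X)).
Implicit Types (V : set (X -> bool)) (L : learner X) (r : run X).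

Lemma best_response_nonempty (h : X -> bool) x : best_response E h x !=set0.
Proof.
rewrite /best_response; case: ifP => [/andP[_ /asboolP//]|_].
by exists x.
Qed.

Definition cons_run (x v : X) (y : bool) r : run X :=
  Run (fun t => if t is s.+1 then arrival r s else x)
      (fun t => if t is s.+1 then move r s else v)
      (fun t => if t is s.+1 then label r s else y).

(** After a first round recorded as [e], [L] acts as the learner [fun p => L (e :: p)]; this permits
    induction over all learners in [adversary_run]. *)
Lemma history_cons_run L x v y r t :
  let e := (x, v, L [::] x v != y) in
  history L (cons_run x v y r) t.+1 = e :: history (fun p => L (e :: p)) r t.
Proof. by move=> e; elim: t => [//|t IH]; rewrite /= in IH *; rewrite IH. Qed.

(** Runs are infinite, so once its mistakes are forced the adversary repeats one instance and
    answers by [h] forever. *)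
Lemma consistent_run L (h : X -> bool) (x : X) :
  exists r, is_run_of E L r /\ forall t, h (move r t) = label r t.
Proof.
have /choice[mv mvP] (past : seq (X * X * bool)) :
    exists v, best_response E (L past x) x v.
  exact: best_response_nonempty.
(* Moves depend on the history and the history on moves; iterating on the history alone breaks the
   circle. *)
pose past t := iter t
  (fun p => rcons p (x, mv p, L p x (mv p) != h (mv p))) [::].
pose r := Run (fun=> x) (fun t => mv (past t)) (fun t => h (mv (past t))).
have hist t : history L r t = past t by elim: t => //= t ->.
by exists r; split => // t; rewrite /hypothesis_at hist; apply: mvP.
Qed.

Hypothesis E_loop : forall x : X, E (x, x).

Lemma forced_mistake V n x (g : X -> bool) :
  ildim_ge E n (restrict V x true) ->
  (forall v, improvement_set E x v -> ildim_ge E n (restrict V v false)) ->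
  exists2 v, best_response E g x v & ildim_ge E n (restrict V v (~~ g v)).
Proof.
move=> Dx Dv; rewrite /best_response.
(* If [g x] is 1 the agent stays, and the self-loop makes [x] one of its own improvements, so answer
   0 is allowed. *)
case gx: (g x) => /=; first by exists x => //; rewrite gx; apply/Dv/E_loop.
case: asboolP => [[v [xv gv]]|_]; last by exists x; rewrite ?gx.
by exists v; rewrite ?gv//; apply: Dv.
Qed.

Lemma adversary_run (x0 : X) n V L : ildim_ge E n V ->
  exists r h, [/\ V h, is_run_of E L r, forall t, h (move r t) = label r t
    & forall t, t < n -> mistake L r t].
Proof.
elim: n V L => [|n IH] V L.
  by case=> h Vh; have [r [? ?]] := consistent_run L h x0; exists r, h.
move=> [x [Dx /(forced_mistake (L [::] x) Dx)[v xv]]].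
set y := ~~ _; pose e := (x, v, L [::] x v != y).
move=> /(IH _ (fun p => L (e :: p)))[r [h [[Vh hv] runr hr mr]]].
exists (cons_run x v y r), h; split => //.
- case=> [//|t]; rewrite /hypothesis_at history_cons_run; exact: runr.
- by case.
- case=> [_|t tn]; first by rewrite /mistake /hypothesis_at /= /y; case: (L _ _ _).
  by rewrite /mistake /hypothesis_at history_cons_run; apply: mr.
Qed.

End Adversary.

(** * The learner *)

Section Learner.
Variables (X : Type) (E : set (X * X)).
Implicit Types (V : set (X -> bool)) (r : run X).

(** The conditions on [V] come after [exists g] so that choice gives a total prediction function. *)
Lemma dimension_reducing_hypothesis V x :
  exists g, V !=set0 -> (exists k, ~ ildim_ge E k V) ->
    forall v, best_response E g x v ->
      exists n, ildim_ge E n V /\ ~ ildim_ge E n (restrict V v (~~ g v)).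
Proof.
have [[V0 [k Dk]]|VN] := pselect (V !=set0 /\ exists k, ~ ildim_ge E k V); last first.
  by exists (fun=> true) => V0 Vk; case: VN.
have [n [Dn nDn]] := ildim_exact V0 Dk.
have [[w [xw nDw]]|noW] := pselect
    (exists w, improvement_set E x w /\ ~ ildim_ge E n (restrict V w false)).
  (* The agent ends at [w], whether or not [w] is [x], so a mistake there reveals label 0. *)
  exists (fun u => `[< u = w >]) => _ _ v.
  have ww : `[< w = w >] by apply/asboolP.
  suff vw : best_response E (fun u => `[< u = w >]) x v -> v = w.
    by move=> /vw ->; exists n; rewrite ww.
  rewrite /best_response; case: asboolP => [xw'|_] /=; first by move=> ->.
  case: asboolP => [_ [_ /asboolP//]|[]].
  by exists w.
exists (fun=> false) => _ _ v.
rewrite /best_response; case: asboolP => [[? []]//|_] /= ->.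
exists n; split=> // Dx; apply: nDn; exists x; split=> // w xw.
by apply: contrapT => nDw; apply: noW; exists w.
Qed.

Lemma optimal_learner V0 : exists L, forall k r, ~ ildim_ge E k V0 ->
  is_run_of E L r -> realizable V0 r ->
  forall t, \sum_(0 <= s < t) mistake L r s < k.
Proof.
have /choice[P HP] (Vx : set (X -> bool) * X) :=
  dimension_reducing_hypothesis Vx.1 Vx.2.
(* The label is recovered as the recomputed prediction xor the mistake bit. *)
pose update V (e : X * X * bool) :=
  restrict V e.1.2 (P (V, e.1.1) e.1.2 (+) e.2).
pose version := foldl update V0.
exists (fun past x => P (version past, x)) => k r nDk; set L := fun _ => _.
move=> runr [h V0h hr] t.
have versionS s : version (history L r s.+1) =
    restrict (version (history L r s)) (move r s) (label r s).
  rewrite /version /= foldl_rcons -/version {1}/update /=.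
  by congr restrict; rewrite /L; case: (P _ _); case: (label _ _).
have hV s : version (history L r s) h.
  by elim: s => [//|s IH]; rewrite versionS; split.
(* Potential argument: [j] strictly bounds the current dimension and drops at each mistake; it stays
   positive since the target [h] is never discarded. *)
suff [j nDj] : exists2 j, ~ ildim_ge E j (version (history L r t)) &
    \sum_(0 <= s < t) mistake L r s + j <= k.
  apply: leq_trans; rewrite -[X in X < _]addn0 ltn_add2l.
  by case: j nDj => // nD0; exfalso; apply: nD0; exists h.
elim: t => [|t [j nDj le_jk]]; first by exists k => //; rewrite big_nil.
rewrite big_nat_recr//= versionS.
case m: (mistake L r t); last first.
  exists j; last by rewrite addn0.
  by move=> D; apply: nDj; apply: ildim_ge_subset D => ? [].
have [] := HP (version (history L r t), arrival r t) _ _ _ (runr t).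
- by exists h; exact: hV.
- by exists j.
move=> n /= [Dn nDn]; exists n.
  move: m nDn; rewrite /mistake /hypothesis_at /L.
  by case: (P _ _); case: (label _ _).
rewrite -addnA (leq_trans _ le_jk)// leq_add2l add1n ltnNge.
by apply/negP => jn; apply: nDj; apply: ildim_ge_leq Dn.
Qed.

End Learner.

(** * Passage to extended real values *)

Section Values.
Variables (R : realType) (X : Type) (E : set (X * X)) (H : set (X -> bool)).
Local Open Scope ring_scope.
Local Open Scope ereal_scope.

Lemma ILdim_ge (x0 : X) n : ildim_ge E n H -> n%:R%:E <= ILdim R E H.
Proof.
move=> /(ildim_ge_shattered x0)[T [shT depT]].
apply: le_trans (ereal_sup_ubound _); last by exists T.
apply: le_ereal_inf_tmp => _ [s Bs <-].
by rewrite lee_fin ler_nat depT.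
Qed.

Lemma ILdim_le n : ~ ildim_ge E n.+1 H -> ILdim R E H <= n%:R%:E.
Proof.
move=> nDn; apply: ge_ereal_sup => _ [T shT <-].
have [s [Bs sn]] : exists s, branch T s /\ (size s <= n)%N.
  apply: contrapT => noS; apply: nDn; apply: shattered_ildim_ge shT _ => s Bs.
  by rewrite ltnNge; apply/negP => sn; apply: noS; exists s.
apply: le_trans (ereal_inf_lbound _) _; first by exists s.
by rewrite lee_fin ler_nat.
Qed.

Lemma mistake_sum (L : learner X) (r : run X) t :
  \sum_(0 <= s < t) ((mistake L r s)%:R : R)%:E =
  (\sum_(0 <= s < t) mistake L r s)%N%:R%:E.
Proof. by rewrite sumEFin natr_sum. Qed.

Lemma optimal_mistakes_ge (E_loop : forall x : X, E (x, x)) (x0 : X) n :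
  ildim_ge E n H -> n%:R%:E <= optimal_mistakes R E H.
Proof.
move=> Dn; apply: le_ereal_inf_tmp => _ [L _ <-].
have [r [h [Hh runr hr mr]]] := adversary_run E_loop x0 L Dn.
apply: le_trans (ereal_sup_ubound _); last first.
  by exists r => //; split=> //; exists h.
(* The terms are nonnegative, so the first [n] rounds bound the series from below. *)
apply: le_trans (nneseries_lim_ge n _) => //.
rewrite mistake_sum lee_fin ler_nat.
rewrite big_nat (eq_bigr (fun=> 1%N)); last by move=> s /mr ->.
by rewrite -big_nat sum_nat_const_nat muln1 subn0.
Qed.

Lemma optimal_mistakes_le n :
  ~ ildim_ge E n.+1 H -> optimal_mistakes R E H <= n%:R%:E.
Proof.
move=> nDn; have [L LP] := optimal_learner E H.
apply: le_trans (ereal_inf_lbound _) _; first by exists L.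
apply: ge_ereal_sup => _ [r [runr Hr] <-].
apply: lime_le; first exact: is_cvg_nneseries.
apply: nearW => t; rewrite mistake_sum lee_fin ler_nat -ltnS.
exact: LP Hr _.
Qed.

End Values.

Theorem theorem1 (R : realType) (X : Type) (E : set (X * X))
    (E_loop : forall x : X, E (x, x))
    (H : set (X -> bool)) (H_nonempty : H !=set0) :
  optimal_mistakes R E H = ILdim R E H.
Proof.
have [[x0 _]|X0] := pselect ([set: X] !=set0); last first.
  (* Without instances there is neither a run nor a tree: both sides are -oo. *)
  have noX (x : X) : False by apply: X0; exists x.
  rewrite /optimal_mistakes /ILdim.
  suff -> : [set ilt_depth R T | T in [set T : ilt E | shattered H T]] = set0.
    rewrite ereal_sup0; apply/eqP; rewrite -leeNy_eq; apply: ereal_inf_lbound.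
    exists (fun _ _ _ => true) => //; rewrite /worst_case_mistakes.
    rewrite (_ : [set _ | _ in _] = set0) ?ereal_sup0 //.
    by apply/seteqP; split => // z [r _ _]; case: (noX (move r 0)).
  by apply/seteqP; split => // z [T _ _]; case: T => x; case: (noX x).
(* Either every level is reached and both sides are [+oo], or both equal the last level reached. *)
have [all_n|] := pselect (forall n, ildim_ge E n H).
  have infinite (z : \bar R) : (forall n, (n%:R%:E <= z)%E) -> z = +oo%E.
    move=> zn; apply: eq_infty => a; apply: le_trans (zn (Num.bound `|a|%R)).
    by rewrite lee_fin (le_trans (ler_norm a))// ltW// archi_boundP.
  rewrite (infinite (ILdim R E H)) => [|n]; last exact: ILdim_ge.
  by apply: infinite => n; apply: optimal_mistakes_ge.
move=> /existsNP[k nDk].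
have [n [Dn nDn]] := ildim_exact H_nonempty nDk.
apply/le_anti/andP; split.
  exact: le_trans (optimal_mistakes_le R nDn) (ILdim_ge R x0 Dn).
exact: le_trans (ILdim_le R nDn) (optimal_mistakes_ge R E_loop x0 Dn).
Qed.
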